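(* Let $\mathcal{A}$ be an additive $k$-category and let $f:X\to Y$ be a morphism in $\mathbf{C}_{[1,n]}(\mathcal{A})$ such that $X$ cannot be extended to the left and $Y$ cannot be extended to the right. If $m\ge n$, then the following conditions are equivalent. (1) $f$ is irreducible in $\mathbf{C}^b(\mathcal{A})$. (2) $f$ is irreducible in $\mathbf{C}_{[0,n+1]}(\mathcal{A})$. (3) $\mathcal{F}_m(f)$ is irreducible in $\mathbf{C}_{\equiv m}(\mathcal{A})$. (4) $f$ is irreducible in $\mathbf{C}_{[1,n]}(\mathcal{A})$.
   Context: $k$ is a commutative ring. $\mathbf{C}^b(\mathcal{A})$ is the category of bounded cochain complexes over $\mathcal{A}$; for integers $a\le b$, $\mathbf{C}_{[a,b]}(\mathcal{A})$ is the full subcategory of complexes with $X^i=0$ for $i\notin[a,b]$; $n\ge 2$. A complex $X=(X^i,d^i)\in\mathbf{C}_{[1,n]}(\mathcal{A})$ can be extended to the left if $d^1:X^1\to X^2$ is not a monomorphism; it can be extended to the right if there are an object $X'^{\,n+1}\in\mathcal{A}$ and a non-zero morphism $d'^{\,n}:X^n\to X'^{\,n+1}$ with $d'^{\,n}d^{n-1}=0$. $\mathbf{C}_{\equiv m}(\mathcal{A})$ is the category of $m$-periodic complexes: complexes $X=(X^i,d_X^i)_{i\in\mathbb{Z}}$ with $X^i=X^j$ and $d_X^i=d_X^j$ whenever $i\equiv j\pmod m$; morphisms are chain maps $(f^i)$ with $f^i=f^j$ whenever $i\equiv j\pmod m$. The compression functor $\mathcal{F}_m:\mathbf{C}^b(\mathcal{A})\to\mathbf{C}_{\equiv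 m}(\mathcal{A})$ is given by $\mathcal{F}_m(X)^i=\bigoplus_{t\in\mathbb{Z}}X^{i+tm}$ with diagonal differential with components $d_X^{i+tm}$, and $\mathcal{F}_m(f)^i$ is diagonal with components $f^{i+tm}$. A morphism $f:X\to Y$ in an additive category is a section (resp. retraction) if there is $h:Y\to X$ with $hf=1_X$ (resp. $fh=1_Y$). It is irreducible if it is neither a section nor a retraction and, whenever $f=hg$, either $g$ is a section or $h$ is a retraction. *)

(* Defs.v *)
From HB Require Import structures.
From mathcomp Require Import all_boot all_order all_algebra.
From mathcomp Require Import boolp.
Set Implicit Arguments.
Unset Strict Implicit.
Unset Printing Implicit Defensive.
Import Order.TTheory GRing.Theory Num.Theory.
Local Open Scope ring_scope.

Record category := Category {
  Ob :> Type;
  Mor : Ob -> Ob -> Type;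
  idm : forall x, Mor x x;
  compm : forall x y z, Mor y z -> Mor x y -> Mor x z;
  comp1m : forall x y (f : Mor x y), compm (idm y) f = f;
  compm1 : forall x y (f : Mor x y), compm f (idm x) = f;
  compA : forall x y z w (h : Mor z w) (g : Mor y z) (f : Mor x y),
    compm h (compm g f) = compm (compm h g) f }.

Record functor (C D : category) := Functor {
  fob :> C -> D;
  fmap : forall x y : C, Mor x y -> Mor (fob x) (fob y);
  fmap1 : forall x, fmap (idm x) = idm (fob x);
  fmapM : forall x y z (g : Mor y z) (f : Mor x y),
    fmap (compm g f) = compm (fmap g) (fmap f) }.

Section Morphisms.
Variable C : category.

Definition monomorphism (x y : C) (f : Mor x y) : Prop :=
  forall (w : C) (u v : Mor w x), compm f u = compm f v -> u = v.

Definition is_section (x y : C) (f : Mor x y) : Prop :=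
  exists h : Mor y x, compm h f = idm x.

Definition is_retraction (x y : C) (f : Mor x y) : Prop :=
  exists h : Mor y x, compm f h = idm y.

Definition irreducible (x y : C) (f : Mor x y) : Prop :=
  [/\ ~ is_section f, ~ is_retraction f &
      forall (z : C) (g : Mor x z) (h : Mor z y),
        f = compm h g -> is_section g \/ is_retraction h].

(* Morphisms with their source and target: an equality [Arrow f = Arrow g]
   is an equality of morphisms whose (co)domains are only provably equal. *)
Record arrow := Arrow { src : C; tgt : C; mor : Mor src tgt }.

End Morphisms.

Section FullSubcategory.
Variable C : category.

Definition full_sub (P : C -> Prop) : category :=
  @Category {x : C | P x} (fun x y => Mor (sval x) (sval y))
    (fun x => idm (sval x)) (fun x y z g f => compm g f)
    (fun x y f => comp1m f) (fun x y f => compm1 f)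
    (fun x y z w h g f => compA h g f).

Definition full_sub_incl (P Q : C -> Prop) (PQ : forall x, P x -> Q x) :
    functor (full_sub P) (full_sub Q) :=
  @Functor (full_sub P) (full_sub Q)
    (fun x => exist Q (sval x) (PQ _ (svalP x)))
    (fun x y f => f) (fun x => erefl) (fun x y z g f => erefl).

End FullSubcategory.

Record kcategory (k : comPzRingType) := KCategory {
  kob :> Type;
  khom : kob -> kob -> lmodType k;
  kid : forall x, khom x x;
  kcomp : forall x y z, khom y z -> khom x y -> khom x z;
  kcomp1m : forall x y (f : khom x y), kcomp (kid y) f = f;
  kcompm1 : forall x y (f : khom x y), kcomp f (kid x) = f;
  kcompA : forall x y z w (h : khom z w) (g : khom y z) (f : khom x y),
    kcomp h (kcomp g f) = kcomp (kcomp h g) f;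
  kcomp_linearr : forall x y z (g : khom y z) (a : k) (f f' : khom x y),
    kcomp g (a *: f + f') = a *: kcomp g f + kcomp g f';
  kcomp_linearl : forall x y z (f : khom x y) (a : k) (g g' : khom y z),
    kcomp (a *: g + g') f = a *: kcomp g f + kcomp g' f }.

Notation "g ∘ f" := (kcomp g f) (at level 40, left associativity).

Definition category_of (k : comPzRingType) (A : kcategory k) : category :=
  @Category A (fun x y => khom x y) (@kid k A) (@kcomp k A)
    (@kcomp1m k A) (@kcompm1 k A) (@kcompA k A).

Definition is_zero (k : comPzRingType) (A : kcategory k) (x : A) : Prop :=
  (forall y (f : khom x y), f = 0) /\ (forall y (f : khom y x), f = 0).

Record additive_kcat (k : comPzRingType) := Additive {
  acat :> kcategory k;
  zob : acat;
  zobP : is_zero zob;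
  dsum : acat -> acat -> acat;
  in1 : forall x y, khom x (dsum x y);
  in2 : forall x y, khom y (dsum x y);
  pr1 : forall x y, khom (dsum x y) x;
  pr2 : forall x y, khom (dsum x y) y;
  pr1_in1 : forall x y, pr1 x y ∘ in1 x y = kid x;
  pr2_in2 : forall x y, pr2 x y ∘ in2 x y = kid y;
  pr1_in2 : forall x y, pr1 x y ∘ in2 x y = 0;
  pr2_in1 : forall x y, pr2 x y ∘ in1 x y = 0;
  dsum_id : forall x y,
    in1 x y ∘ pr1 x y + in2 x y ∘ pr2 x y = kid (dsum x y) }.

Arguments in1 {k a} x y.
Arguments in2 {k a} x y.
Arguments pr1 {k a} x y.
Arguments pr2 {k a} x y.
Arguments zob {k} a.

Section LinearTheory.
Variables (k : comPzRingType) (A : kcategory k).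
Implicit Types x y z : A.

Lemma kcompDr x y z (g : khom y z) (f f' : khom x y) :
  g ∘ (f + f') = g ∘ f + g ∘ f'.
Proof. by have := kcomp_linearr g 1 f f'; rewrite !scale1r. Qed.

Lemma kcompDl x y z (f : khom x y) (g g' : khom y z) :
  (g + g') ∘ f = g ∘ f + g' ∘ f.
Proof. by have := kcomp_linearl f 1 g g'; rewrite !scale1r. Qed.

Lemma kcompm0 x y z (g : khom y z) : g ∘ (0 : khom x y) = 0.
Proof. by apply: (addrI (g ∘ (0 : khom x y))); rewrite -kcompDr !addr0. Qed.

Lemma kcomp0m x y z (f : khom x y) : (0 : khom y z) ∘ f = 0.
Proof. by apply: (addrI ((0 : khom y z) ∘ f)); rewrite -kcompDl !addr0. Qed.

Lemma kcomp_suml x y z (f : khom x y) (s : seq int) (g : int -> khom y z) :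
  (\sum_(i <- s) g i) ∘ f = \sum_(i <- s) (g i ∘ f).
Proof.
by elim: s => [|i s IH]; rewrite ?big_nil ?kcomp0m // !big_cons kcompDl IH.
Qed.

Lemma kcomp_sumr x y z (g : khom y z) (s : seq int) (f : int -> khom x y) :
  g ∘ (\sum_(i <- s) f i) = \sum_(i <- s) (g ∘ f i).
Proof.
by elim: s => [|i s IH]; rewrite ?big_nil ?kcompm0 // !big_cons kcompDr IH.
Qed.

End LinearTheory.

Section BigDirectSum.
Variables (k : comPzRingType) (A : additive_kcat k) (X : int -> A).
Implicit Types (s : seq int) (i j : int).

Fixpoint bigdsum s : A :=
  if s is i :: s' then dsum (X i) (bigdsum s') else zob A.

Definition eq_id i j (e : i = j) : khom (X i) (X j) :=
  match e in _ = j' return khom (X i) (X j') with erefl => kid (X i) end.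

(* For [i] not in [s], [bigin s i] and [bigpr s i] are 0. *)
Fixpoint bigin s i : khom (X i) (bigdsum s) :=
  match s with
  | [::] => 0
  | j :: s' => match @eqP _ i j with
               | ReflectT e => in1 (X j) (bigdsum s') ∘ eq_id e
               | ReflectF _ => in2 (X j) (bigdsum s') ∘ bigin s' i
               end
  end.

Fixpoint bigpr s i : khom (bigdsum s) (X i) :=
  match s with
  | [::] => 0
  | j :: s' => match @eqP _ j i with
               | ReflectT e => eq_id e ∘ pr1 (X j) (bigdsum s')
               | ReflectF _ => bigpr s' i ∘ pr2 (X j) (bigdsum s')
               end
  end.

Definition copair s (z : A) (u : forall i, khom (X i) z) : khom (bigdsum s) z :=
  \sum_(i <- s) (u i ∘ bigpr s i).

Lemma eq_id1 i (e : i = i) : eq_id e = kid (X i).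
Proof. by rewrite (Prop_irrelevance e erefl). Qed.

Lemma bigin_notin s i : i \notin s -> bigin s i = 0.
Proof.
elim: s => [|j s IH] //=; rewrite inE negb_or => /andP[ne /IH->].
by case: eqP ne => // _ _; rewrite kcompm0.
Qed.

Lemma bigin_hd j s : bigin (j :: s) j = in1 (X j) (bigdsum s).
Proof. by rewrite /=; case: eqP => // e; rewrite eq_id1 kcompm1. Qed.

Lemma bigpr_hd j s : bigpr (j :: s) j = pr1 (X j) (bigdsum s).
Proof. by rewrite /=; case: eqP => // e; rewrite eq_id1 kcomp1m. Qed.

Lemma bigin_tl j s i : i != j -> bigin (j :: s) i = in2 (X j) _ ∘ bigin s i.
Proof. by rewrite /=; case: eqP. Qed.

Lemma bigpr_tl j s i : i != j -> bigpr (j :: s) i = bigpr s i ∘ pr2 (X j) _.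
Proof. by rewrite eq_sym /=; case: eqP. Qed.

Lemma bigpr_in s i : i \in s -> bigpr s i ∘ bigin s i = kid (X i).
Proof.
elim: s => [|j s IH] //; case: (eqVneq i j) => [->|ne].
  by rewrite bigin_hd bigpr_hd pr1_in1.
rewrite inE (negbTE ne) orFb => /IH <-; rewrite bigin_tl // bigpr_tl //.
by rewrite -kcompA (kcompA (pr2 _ _)) pr2_in2 kcomp1m.
Qed.

Lemma bigpr_in0 s i j : i != j -> bigpr s i ∘ bigin s j = 0.
Proof.
move=> ne; elim: s => [|l s IH]; first by rewrite /= kcompm0.
have [ei|ni] := eqVneq i l.
  have nj : j != l by rewrite -ei eq_sym.
  by subst l; rewrite bigpr_hd bigin_tl // kcompA pr1_in2 kcomp0m.
have [ej|nj] := eqVneq j l.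
  by subst l; rewrite bigin_hd bigpr_tl // -kcompA pr2_in1 kcompm0.
by rewrite bigin_tl // bigpr_tl // -kcompA (kcompA (pr2 _ _)) pr2_in2 kcomp1m.
Qed.

Lemma bigdsum_id s : uniq s ->
  \sum_(i <- s) (bigin s i ∘ bigpr s i) = kid (bigdsum s).
Proof.
elim: s => [_|j s IH /andP[js us]].
  by rewrite big_nil /= (proj1 (zobP A) _ (kid _)).
rewrite big_cons bigin_hd bigpr_hd -dsum_id; congr (_ + _).
rewrite big_seq_cond (eq_bigr (fun i =>
  in2 (X j) (bigdsum s) ∘ (bigin s i ∘ bigpr s i)
    ∘ pr2 (X j) (bigdsum s))).
  by rewrite -big_seq_cond -kcomp_suml -kcomp_sumr IH // kcompm1.
move=> i; rewrite andbT => ins; have ne : i != j by apply: contraNneq js => <-.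
by rewrite bigin_tl // bigpr_tl // !kcompA.
Qed.

Lemma bigdsum_ext s z (u v : khom (bigdsum s) z) : uniq s ->
  (forall i, i \in s -> u ∘ bigin s i = v ∘ bigin s i) -> u = v.
Proof.
move=> us uv; rewrite -(kcompm1 u) -(kcompm1 v) -bigdsum_id // !kcomp_sumr.
by apply: eq_big_seq => i /uv; rewrite !kcompA => ->.
Qed.

Lemma copair_in s z (u : forall i, khom (X i) z) i : uniq s -> i \in s ->
  copair s u ∘ bigin s i = u i.
Proof.
move=> us ins; rewrite kcomp_suml (bigD1_seq i) //= big1 ?addr0.
  by rewrite -kcompA bigpr_in // kcompm1.
by move=> j ne; rewrite -kcompA bigpr_in0 // kcompm0.
Qed.

End BigDirectSum.

Section Complexes.
Variables (k : comPzRingType) (A : additive_kcat k).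

Record cochain := Cochain {
  cob :> int -> A;
  cd : forall i, khom (cob i) (cob (i + 1));
  cdd : forall i, cd (i + 1) ∘ cd i = 0 }.

Record chain_map (X Y : cochain) := ChainMap {
  cmap :> forall i, khom (X i) (Y i);
  cmapP : forall i, cd Y i ∘ cmap i = cmap (i + 1) ∘ cd X i }.

Lemma chain_map_eq X Y (f g : chain_map X Y) : (forall i, f i = g i) -> f = g.
Proof.
case: f g => [f fP] [g gP] /= fg.
have e : f = g by apply: functional_extensionality_dep.
by subst g; rewrite (Prop_irrelevance fP gP).
Qed.

Fact chain_id_subproof X i : cd X i ∘ kid (X i) = kid (X (i + 1)) ∘ cd X i.
Proof. by rewrite kcomp1m kcompm1. Qed.
Definition chain_id X : chain_map X X := ChainMap (chain_id_subproof X).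

Fact chain_comp_subproof X Y Z (g : chain_map Y Z) (f : chain_map X Y) i :
  cd Z i ∘ (g i ∘ f i) = g (i + 1) ∘ f (i + 1) ∘ cd X i.
Proof. by rewrite kcompA cmapP -kcompA cmapP kcompA. Qed.
Definition chain_comp X Y Z (g : chain_map Y Z) (f : chain_map X Y) :
  chain_map X Z := ChainMap (chain_comp_subproof g f).

Fact chain_comp1m X Y (f : chain_map X Y) : chain_comp (chain_id Y) f = f.
Proof. by apply: chain_map_eq => i /=; rewrite kcomp1m. Qed.
Fact chain_compm1 X Y (f : chain_map X Y) : chain_comp f (chain_id X) = f.
Proof. by apply: chain_map_eq => i /=; rewrite kcompm1. Qed.
Fact chain_compA X Y Z W (h : chain_map Z W) (g : chain_map Y Z)
  (f : chain_map X Y) :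
  chain_comp h (chain_comp g f) = chain_comp (chain_comp h g) f.
Proof. by apply: chain_map_eq => i /=; rewrite kcompA. Qed.

Definition C_all : category :=
  @Category cochain chain_map chain_id chain_comp
    chain_comp1m chain_compm1 chain_compA.

(* "X^i = 0" means: X^i is a zero object, not necessarily the chosen one. *)
Definition concentrated (a b : int) (X : C_all) : Prop :=
  forall i, ~~ (a <= i <= b) -> is_zero (cob X i).

Definition bounded (X : C_all) : Prop := exists a b, concentrated a b X.

Definition C_ (a b : int) : category := full_sub (concentrated a b).

Definition C_b : category := full_sub bounded.

Definition incl_b (a b : int) : functor (C_ a b) C_b :=
  full_sub_incl (fun X cX => ex_intro _ a (ex_intro _ b cX)).

Lemma concentrated_widen (a b a' b' : int) : a' <= a -> b <= b' ->
  forall X, concentrated a b X -> concentrated a' b' X.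
Proof.
move=> aa bb X cX i ni; apply: cX; apply: contra ni => /andP[ai ib].
by rewrite (le_trans aa ai) (le_trans ib bb).
Qed.

Definition incl_widen (a b a' b' : int) (aa : a' <= a) (bb : b <= b') :
  functor (C_ a b) (C_ a' b') := full_sub_incl (concentrated_widen aa bb).

Fact incl_0_subproof : 0 <= 1 :> int. Proof. by []. Qed.
Fact incl_S_subproof (n : int) : n <= n + 1. Proof. by rewrite lerDl. Qed.

Definition incl_1n (n : int) : functor (C_ 1 n) (C_ 0 (n + 1)) :=
  incl_widen incl_0_subproof (incl_S_subproof n).

Definition left_extendable (X : cochain) : Prop :=
  ~ @monomorphism (category_of A) _ _ (cd X 1).

(* X^n is written [X (n - 1 + 1)], the codomain of d^(n-1). *)
Definition right_extendable (n : int) (X : cochain) : Prop :=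
  exists (Z : A) (d' : khom (X (n - 1 + 1)) Z),
    d' <> 0 /\ d' ∘ cd X (n - 1) = 0.

Section Periodic.
Variable m : nat.

Definition mcong (i j : int) : Prop := (i = j %[mod m])%Z.

Definition AArrow (x y : A) (f : khom x y) : arrow (category_of A) :=
  @Arrow (category_of A) x y f.

Definition periodic (X : cochain) : Prop := forall i j, mcong i j ->
  X i = X j /\ AArrow (cd X i) = AArrow (cd X j).

Definition periodic_map (X Y : cochain) (f : chain_map X Y) : Prop :=
  forall i j, mcong i j -> AArrow (f i) = AArrow (f j).

Lemma AArrow_id (x y : A) : x = y -> AArrow (kid x) = AArrow (kid y).
Proof. by move->. Qed.

Lemma AArrow_comp (x y z x' y' z' : A) (f : khom x y) (g : khom y z)
    (f' : khom x' y') (g' : khom y' z') :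
  AArrow f = AArrow f' -> AArrow g = AArrow g' ->
  AArrow (g ∘ f) = AArrow (g' ∘ f').
Proof.
move=> ef eg.
pose Q (a b : arrow (category_of A)) := forall e : tgt a = src b,
  AArrow (g ∘ f) = AArrow (mor b ∘
    match e in _ = w return khom (src a) w with erefl => mor a end).
suff: Q (AArrow f') (AArrow g') by move/(_ erefl).
by rewrite -ef -eg => e /=; rewrite (Prop_irrelevance e erefl).
Qed.

Definition pcochain := {X : cochain | periodic X}.

Record pchain_map (X Y : pcochain) := PChainMap {
  pmap :> chain_map (sval X) (sval Y);
  pmapP : periodic_map pmap }.

Lemma pchain_map_eq X Y (f g : pchain_map X Y) : (forall i, f i = g i) -> f = g.
Proof.
case: f g => [f fP] [g gP] /= /chain_map_eq e.
by subst g; rewrite (Prop_irrelevance fP gP).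
Qed.

Fact pchain_id_subproof (X : pcochain) : periodic_map (chain_id (sval X)).
Proof. by move=> i j /(svalP X)[e _]; apply: AArrow_id. Qed.
Definition pchain_id X : pchain_map X X := PChainMap (@pchain_id_subproof X).

Fact pchain_comp_subproof X Y Z (g : pchain_map Y Z) (f : pchain_map X Y) :
  periodic_map (chain_comp g f).
Proof. by move=> i j e; apply: AArrow_comp; apply: pmapP. Qed.
Definition pchain_comp X Y Z (g : pchain_map Y Z) (f : pchain_map X Y) :
  pchain_map X Z := PChainMap (pchain_comp_subproof g f).

Fact pchain_comp1m X Y (f : pchain_map X Y) : pchain_comp (pchain_id Y) f = f.
Proof. by apply: pchain_map_eq => i /=; rewrite kcomp1m. Qed.
Fact pchain_compm1 X Y (f : pchain_map X Y) : pchain_comp f (pchain_id X) = f.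
Proof. by apply: pchain_map_eq => i /=; rewrite kcompm1. Qed.
Fact pchain_compA X Y Z W (h : pchain_map Z W) (g : pchain_map Y Z)
  (f : pchain_map X Y) :
  pchain_comp h (pchain_comp g f) = pchain_comp (pchain_comp h g) f.
Proof. by apply: pchain_map_eq => i /=; rewrite kcompA. Qed.

Definition C_per : category :=
  @Category pcochain pchain_map pchain_id pchain_comp
    pchain_comp1m pchain_compm1 pchain_compA.

(* A chosen interval [lo X, hi X] outside of which X is 0; another choice
   changes the direct sums below by zero summands only. *)
Definition lo (X : C_b) : int := sval (cid (svalP X)).
Definition hi (X : C_b) : int := sval (cid (svalP (cid (svalP X)))).

Lemma lo_hi (X : C_b) : concentrated (lo X) (hi X) (sval X).
Proof. exact: (svalP (cid (svalP (cid (svalP X))))). Qed.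

Definition zrange (a b : int) : seq int :=
  [seq l <- [seq a + j%:Z | j <- iota 0 `|b - a|%N.+1] | a <= l <= b].

(* The integers i + tm (t in Z) lying in [lo X, hi X].
   Listing the values i + tm rather than the t's makes the direct sum below
   strictly periodic in i. *)
Definition supp (X : C_b) (i : int) : seq int :=
  [seq l <- zrange (lo X) (hi X) | (l == i %[mod m])%Z].

Lemma mem_zrange a b l : (l \in zrange a b) = (a <= l <= b).
Proof.
rewrite mem_filter andbC; apply/andP/idP => [[]//|ab]; split=> //.
have /andP[al lb] := ab; apply/mapP; exists `|l - a|%N.
  rewrite mem_iota /= add0n ltnS -lez_nat !abszE !ger0_norm ?subr_ge0 //.
    by rewrite lerD2r.
  exact: le_trans al lb.
by rewrite abszE ger0_norm ?subr_ge0 // [RHS]addrC subrK.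
Qed.

Lemma supp_uniq X i : uniq (supp X i).
Proof.
rewrite !filter_uniq // map_inj_uniq ?iota_uniq // => j j' /addrI.
by case.
Qed.

Lemma mem_supp X i l :
  (l \in supp X i) = (lo X <= l <= hi X) && (l == i %[mod m])%Z.
Proof. by rewrite mem_filter mem_zrange andbC. Qed.

Lemma supp_cong X i j : mcong i j -> supp X i = supp X j.
Proof. by rewrite /mcong /supp => ->. Qed.

Lemma mcongS i j : mcong i j -> mcong (i + 1) (j + 1).
Proof. by rewrite /mcong => e; rewrite -modzDml e modzDml. Qed.

Definition Fob (X : C_b) (i : int) : A := bigdsum (sval X) (supp X i).

Definition diff_on (X : cochain) (s s' : seq int) :
    khom (bigdsum X s) (bigdsum X s') :=
  copair s (fun l => bigin X s' (l + 1) ∘ cd X l).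

Definition map_on (X Y : cochain) (f : chain_map X Y) (s s' : seq int) :
    khom (bigdsum X s) (bigdsum Y s') :=
  copair s (fun l => bigin Y s' l ∘ f l).

Definition Fd (X : C_b) (i : int) : khom (Fob X i) (Fob X (i + 1)) :=
  diff_on (sval X) (supp X i) (supp X (i + 1)).

Definition Fmap (X Y : C_b) (f : Mor X Y) (i : int) :
    khom (Fob X i) (Fob Y i) :=
  map_on f (supp X i) (supp Y i).

Lemma out_supp (X : C_b) i l : mcong l i -> l \notin supp X i ->
  is_zero (cob (sval X) l).
Proof.
move=> /eqP e; rewrite mem_supp e andbT => nl; exact: (lo_hi (X := X)).
Qed.

Lemma mem_supp_cong X i l : l \in supp X i -> mcong l i.
Proof. by rewrite mem_supp => /andP[_ /eqP]. Qed.

Lemma Fd_in (X : C_b) i l : mcong l i ->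
  Fd X i ∘ bigin (sval X) (supp X i) l =
  bigin (sval X) (supp X (i + 1)) (l + 1) ∘ cd (sval X) l.
Proof.
move=> e; have [lin|lout] := boolP (l \in supp X i).
  by rewrite /Fd /diff_on copair_in ?supp_uniq.
have [Z0 _] := out_supp e lout.
by rewrite bigin_notin // kcompm0 (Z0 _ (cd _ _)) kcompm0.
Qed.

Lemma Fmap_in (X Y : C_b) (f : Mor X Y) i l : mcong l i ->
  Fmap f i ∘ bigin (sval X) (supp X i) l =
  bigin (sval Y) (supp Y i) l ∘ (f : chain_map _ _) l.
Proof.
move=> e; have [lin|lout] := boolP (l \in supp X i).
  by rewrite /Fmap /map_on copair_in ?supp_uniq.
have [Z0 _] := out_supp e lout.
by rewrite bigin_notin // kcompm0 (Z0 _ (cmap f l)) kcompm0.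
Qed.

Fact Fdd X i : Fd X (i + 1) ∘ Fd X i = 0.
Proof.
apply: bigdsum_ext (supp_uniq _ _) _ => l /mem_supp_cong e.
rewrite -kcompA Fd_in // kcompA Fd_in; last exact: mcongS.
by rewrite -kcompA cdd kcompm0 kcomp0m.
Qed.

Definition Fcochain (X : C_b) : cochain := Cochain (Fdd X).

Fact Fcochain_periodic X : periodic (Fcochain X).
Proof.
move=> i j e; split; first by rewrite /= /Fob (supp_cong X e).
by rewrite /= /Fd /Fob (supp_cong X e) (supp_cong X (mcongS e)).
Qed.

Definition Fpcochain (X : C_b) : C_per :=
  exist _ (Fcochain X) (@Fcochain_periodic X).

Fact Fmap_chain (X Y : C_b) (f : Mor X Y) i :
  cd (Fcochain Y) i ∘ Fmap f i = Fmap f (i + 1) ∘ cd (Fcochain X) i.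
Proof.
apply: bigdsum_ext (supp_uniq _ _) _ => l /mem_supp_cong e /=.
rewrite -kcompA Fmap_in // kcompA Fd_in //.
rewrite -[in RHS]kcompA Fd_in // kcompA Fmap_in; last exact: mcongS.
by rewrite -!kcompA cmapP.
Qed.

Definition Fchain (X Y : C_b) (f : Mor X Y) :
  chain_map (Fcochain X) (Fcochain Y) :=
  @ChainMap (Fcochain X) (Fcochain Y) (Fmap f) (Fmap_chain f).

Fact Fchain_periodic (X Y : C_b) (f : Mor X Y) : periodic_map (Fchain f).
Proof.
by move=> i j e; rewrite /= /Fmap /Fob (supp_cong X e) (supp_cong Y e).
Qed.

Definition Fpchain (X Y : C_b) (f : Mor X Y) :
  Mor (Fpcochain X) (Fpcochain Y) :=
  @PChainMap (Fpcochain X) (Fpcochain Y) (Fchain f) (@Fchain_periodic X Y f).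

Fact Fpchain1 X : Fpchain (idm X) = idm (Fpcochain X).
Proof.
apply: pchain_map_eq => i /=.
apply: bigdsum_ext (supp_uniq _ _) _ => l /mem_supp_cong e.
by rewrite Fmap_in //= kcompm1 kcomp1m.
Qed.

Fact FpchainM X Y Z (g : Mor Y Z) (f : Mor X Y) :
  Fpchain (compm g f) = compm (Fpchain g) (Fpchain f).
Proof.
apply: pchain_map_eq => i /=.
apply: bigdsum_ext (supp_uniq _ _) _ => l /mem_supp_cong e.
by rewrite Fmap_in //= -[RHS]kcompA Fmap_in // [RHS]kcompA Fmap_in // -kcompA.
Qed.

Definition compression : functor C_b C_per := Functor Fpchain1 FpchainM.

End Periodic.
End Complexes.

Arguments C_ {k} A a b.
Arguments C_b {k} A.
Arguments C_per {k} A m.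
Arguments incl_b {k} A a b.
Arguments incl_1n {k} A n.
Arguments compression {k} A m.

(* Main.v *)
Require Import Defs.
From mathcomp Require Import all_boot all_order all_algebra.
From mathcomp Require Import boolp zify.
Local Open Scope ring_scope.

Set Implicit Arguments.
Unset Strict Implicit.
Unset Printing Implicit Defensive.
Import Order.TTheory GRing.Theory Num.Theory.

(** Let [J] be the embedding of [C_[1,n]] into [D], where [D] is the category of
    bounded complexes or, after compression, that of [m]-periodic complexes.
    Brutal truncation to the degrees [1..n] is a functor [T : D -> C_[1,n]], and
    [T J] is naturally isomorphic to the identity. For periodic complexes this
    is where [n <= m] enters: the compression of [X] is the sum of the shifts of
    [X] by the multiples of [m], and only [X] itself meets the degrees [1..n].

    A factorization [J f = h g] in [D] therefore truncates to the factorization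
    [f = T h . T g] in [C_[1,n]], so if [f] is irreducible there is a left
    inverse [s : T Z -> X] of [T g] or a right inverse [r : Y -> T Z] of [T h].
    It remains to lift [s] or [r] to [D], which is what the conditions on [X]
    and [Y] provide. Extended by zero, [s] is a chain map [Z -> X] as soon as
    [s^1 d_Z^0 = 0]; this holds because [d_X^1 s^1 d_Z^0 = s^2 d_Z^1 d_Z^0 = 0]
    and [d_X^1] is a monomorphism. Dually, [r] is a chain map [Y -> Z] as soon as
    [d_Z^n r^n = 0], and this holds because [d_Z^n r^n d_Y^(n-1) = 0] and [Y]
    cannot be extended to the right. For periodic [Z] nothing more is needed:
    compression is both a left and a right adjoint of the functor which forgets
    periodicity, so chain maps [Z -> X] are the same as periodic maps from [Z]
    to the compression of [X], and likewise on the other side.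

    The lifting statements are phrased as universal properties, [couniversal]
    at [X] and [universal] at [Y]. They compose ([couniversal_comp],
    [universal_comp]), so that truncation ([trunc_couniversal],
    [trunc_universal]) and compression ([Fpr_couniversal], [Fin_universal]) are
    treated separately. [irreducible_transfer] then gives the passage from
    [C_[1,n]] to [D]. Conversely, the functors at hand are full embeddings or
    have a left inverse up to isomorphism; in both cases they reflect sections
    and retractions, hence irreducibility ([irreducible_reflect]). *)

(** * Irreducible morphisms and functors *)

Definition comp_functor (B C D : category) (G : functor C D) (F : functor B C) :
  functor B D.
Proof.
exists (fun x => G (F x)) (fun x y f => fmap G (fmap F f)) => [x|x y z g f].
- by rewrite !fmap1.
- by rewrite !fmapM.
Defined.

Lemma comp_inverse (C : category) (x y z : C) (p : Mor y z) (i : Mor z y)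
    (q : Mor x y) (j : Mor y x) :
  compm p i = idm z -> compm q j = idm y ->
  compm (compm p q) (compm j i) = idm z.
Proof. by move=> pi qj; rewrite -Defs.compA (Defs.compA q) qj comp1m. Qed.

Section Transfer.
Variables C D : category.
Implicit Types (J : functor C D) (T : functor D C).

Definition reflects_split J : Prop := forall (x y : C) (g : Mor x y),
  (is_section (fmap J g) -> is_section g) /\
  (is_retraction (fmap J g) -> is_retraction g).

(** Every functor preserves sections and retractions, so reflecting them is all
    that is needed to push a factorization forward and pull its splitting back. *)
Lemma irreducible_reflect J (x y : C) (f : Mor x y) :
  reflects_split J -> irreducible (fmap J f) -> irreducible f.
Proof.
move=> JR [ns nr fact]; split.
- by case=> h hf; apply: ns; exists (fmap J h); rewrite -fmapM hf fmap1.
- by case=> h fh; apply: nr; exists (fmap J h); rewrite -fmapM fh fmap1.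
- move=> z g h fE; have [|s|r] := fact _ (fmap J g) (fmap J h).
  + by rewrite fE fmapM.
  + by left; have [+ _] := JR _ _ g; apply.
  + by right; have [_ +] := JR _ _ h; apply.
Qed.

(** [d] represents the functor [Mor (T _) x], with universal element [p]: this
    is the universal property of a value at [x] of a right adjoint of [T],
    required at the single object [x]. *)
Definition couniversal T (x : C) (d : D) (p : Mor (T d) x) : Prop :=
  forall (z : D) (s : Mor (T z) x),
    exists! u : Mor z d, compm p (fmap T u) = s.

(** The dual: [d] has the universal property of the value at [x] of a left
    adjoint of [T]. *)
Definition universal T (x : C) (d : D) (i : Mor x (T d)) : Prop :=
  forall (z : D) (r : Mor x (T z)),
    exists! u : Mor d z, compm (fmap T u) i = r.

Lemma couniversal_inj T x d (p : Mor (T d) x) (z : D) (u v : Mor z d) :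
  couniversal p -> compm p (fmap T u) = compm p (fmap T v) -> u = v.
Proof.
by move=> /(_ z (compm p (fmap T v)))[w [_ wU]] e; rewrite -(wU u) // -(wU v).
Qed.

Lemma universal_inj T x d (i : Mor x (T d)) (z : D) (u v : Mor d z) :
  universal i -> compm (fmap T u) i = compm (fmap T v) i -> u = v.
Proof.
by move=> /(_ z (compm (fmap T v) i))[w [_ wU]] e; rewrite -(wU u) // -(wU v).
Qed.

Section LeftInverse.
Variables (J : functor C D) (T : functor D C).
Variables (p : forall x, Mor (T (J x)) x) (i : forall x, Mor x (T (J x))).

Definition left_inverse_of : Prop :=
  [/\ forall x y (f : Mor x y), compm (p y) (fmap T (fmap J f)) = compm f (p x),
      forall x, compm (p x) (i x) = idm x &
      forall x, compm (i x) (p x) = idm (T (J x))].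

Hypothesis pi : left_inverse_of.

Let pN : forall x y (f : Mor x y),
  compm (p y) (fmap T (fmap J f)) = compm f (p x).
Proof. by case: pi. Qed.
Let piK x : compm (p x) (i x) = idm x. Proof. by case: pi. Qed.
Let ipK x : compm (i x) (p x) = idm (T (J x)). Proof. by case: pi. Qed.
Let iN : forall x y (f : Mor x y),
  compm (fmap T (fmap J f)) (i x) = compm (i y) f.
Proof.
move=> x y f; rewrite -[LHS]comp1m -ipK -Defs.compA (Defs.compA (p y)) pN.
by rewrite -(Defs.compA f) piK compm1.
Qed.

Lemma left_inverse_reflects_split : reflects_split J.
Proof.
move=> x y g; split=> -[h hE].
- exists (compm (p x) (compm (fmap T h) (i y))).
  by rewrite -!Defs.compA -iN (Defs.compA (fmap T h)) -fmapM hE fmap1 comp1m piK.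
- exists (compm (p x) (compm (fmap T h) (i y))).
  rewrite Defs.compA -pN -Defs.compA (Defs.compA (fmap T _)) -fmapM hE.
  by rewrite fmap1 comp1m piK.
Qed.

(** A factorization of [J f] is sent by [T] to a factorization of [f], whose
    splitting is lifted back along the universal properties; uniqueness in these
    properties shows that the lift is still a one-sided inverse. The property at
    the source lifts left inverses of [g], the one at the target right inverses
    of [h]. *)
Lemma irreducible_transfer x y (f : Mor x y) :
  couniversal (p x) -> universal (i y) -> irreducible f ->
  irreducible (fmap J f).
Proof.
move=> cx uy [ns nr fact]; split.
- by move/(left_inverse_reflects_split _).1.
- by move/(left_inverse_reflects_split _).2.
move=> z g h fE.
have [|[s sE]|[r rE]] :=
  fact (T z) (compm (fmap T g) (i x)) (compm (p y) (fmap T h)).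
- by rewrite -Defs.compA (Defs.compA (fmap T h)) -fmapM -fE iN Defs.compA piK comp1m.
- left; have [u [uE _]] := cx z s; exists u; apply: (couniversal_inj cx).
  rewrite fmapM Defs.compA uE fmap1 compm1.
  by rewrite -[LHS]compm1 -ipK !Defs.compA -(Defs.compA s) sE comp1m.
- right; have [u [uE _]] := uy z r; exists u; apply: (universal_inj uy).
  rewrite fmapM -Defs.compA uE fmap1 comp1m.
  by rewrite -[LHS]comp1m -ipK -!Defs.compA (Defs.compA (p y)) rE compm1.
Qed.

End LeftInverse.
End Transfer.

Section UniversalComp.
Variables (C D E : category) (T : functor D C) (U : functor E D).

Lemma couniversal_comp x d e (p : Mor (T d) x) (q : Mor (U e) d) :
  couniversal p -> couniversal q ->
  couniversal (T := comp_functor T U) (compm p (fmap T q)).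
Proof.
move=> cp cq z s; have [v [vE vU]] := cp _ s; have [u [uE uU]] := cq _ v.
exists u; split=> [|w wE] /=; first by rewrite -Defs.compA -fmapM uE.
by apply: uU; rewrite -(vU (compm q (fmap U w))) // fmapM Defs.compA.
Qed.

Lemma universal_comp x d e (i : Mor x (T d)) (j : Mor d (U e)) :
  universal i -> universal j ->
  universal (T := comp_functor T U) (compm (fmap T j) i).
Proof.
move=> ui uj z r; have [v [vE vU]] := ui _ r; have [u [uE uU]] := uj _ v.
exists u; split=> [|w wE] /=; first by rewrite Defs.compA -fmapM uE.
by apply: uU; rewrite -(vU (compm (fmap U w) j)) // fmapM -Defs.compA.
Qed.

End UniversalComp.

Section FullSub.
Variables (C : category) (P Q : C -> Prop) (PQ : forall x, P x -> Q x).

Lemma full_sub_reflects_split : reflects_split (full_sub_incl PQ).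
Proof. by move=> x y g; split=> -[h hE]; exists h. Qed.

Definition full_sub_forget : functor (full_sub P) C :=
  @Functor (full_sub P) C (fun x => sval x) (fun x y f => f)
    (fun x => erefl) (fun x y z g f => erefl).

Lemma full_sub_couniversal (x : full_sub P) :
  couniversal (T := full_sub_forget) (d := x) (idm (sval x)).
Proof. by move=> z s; exists s; split=> [|u <-]; rewrite ?comp1m. Qed.

Lemma full_sub_universal (x : full_sub P) :
  universal (T := full_sub_forget) (d := x) (idm (sval x)).
Proof. by move=> z s; exists s; split=> [|u <-]; rewrite ?compm1. Qed.

End FullSub.

(** * Brutal truncation *)

Section Truncation.
Variables (k : comPzRingType) (A : additive_kcat k).

Lemma zero_src (x y : A) (f g : khom x y) : is_zero x -> f = g.
Proof. by case=> e _; rewrite (e _ f) (e _ g). Qed.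

Lemma zero_tgt (x y : A) (f g : khom x y) : is_zero y -> f = g.
Proof. by case=> _ e; rewrite (e _ f) (e _ g). Qed.

(** With [cut_in] and [cut_pr] the truncated differential is a composite, so no
    case analysis on the degree is needed to type it. The boolean still occurs in
    the types of its components, hence the splits on [orP (orbN _)] below: they do
    not abstract it from the goal. *)
Definition cut (b : bool) (x : A) : A := if b then x else zob A.
Definition cut_in (b : bool) (x : A) : khom (cut b x) x :=
  if b return khom (cut b x) x then kid x else 0.
Definition cut_pr (b : bool) (x : A) : khom x (cut b x) :=
  if b return khom x (cut b x) then kid x else 0.

Lemma cut_zero b x : ~~ b -> is_zero (cut b x).
Proof. by case: b => // _; apply: zobP. Qed.

Lemma cut_inK b x : cut_pr b x ∘ cut_in b x = kid (cut b x).
Proof.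
case: b => /=; first by rewrite kcomp1m.
by apply: zero_src; apply: zobP.
Qed.

Lemma cut_prK (b : bool) x : b -> cut_in b x ∘ cut_pr b x = kid x.
Proof. by case: b => //= _; rewrite kcomp1m. Qed.

Variables a b : int.
Notation inab i := (a <= i <= b).

Lemma cut_prKz (X : cochain A) i : concentrated a b X ->
  cut_in (inab i) (X i) ∘ cut_pr (inab i) (X i) = kid (X i).
Proof.
move=> cX; have [ib|nib] := orP (orbN (inab i)); first by rewrite cut_prK.
by apply: zero_src; apply: cX.
Qed.

Definition trunc_ob (X : cochain A) (i : int) : A := cut (inab i) (X i).

Definition trunc_d (X : cochain A) i : khom (trunc_ob X i) (trunc_ob X (i + 1)) :=
  cut_pr _ _ ∘ cd X i ∘ cut_in _ _.

Fact trunc_dd X i : trunc_d X (i + 1) ∘ trunc_d X i = 0.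
Proof.
have [ib|nib] := orP (orbN (inab (i + 1))); last first.
  rewrite (zero_src (trunc_d X (i + 1)) 0) ?kcomp0m //; exact: cut_zero.
rewrite /trunc_d -!kcompA (kcompA (cut_in (inab (i + 1)) _)) cut_prK // kcomp1m.
by rewrite (kcompA (cd X (i + 1))) cdd kcomp0m kcompm0.
Qed.

Definition trunc_cochain X : cochain A := Cochain (trunc_dd X).

Fact trunc_concentrated X : concentrated a b (trunc_cochain X).
Proof. by move=> i; apply: cut_zero. Qed.

Definition trunc_map_at (X Y : cochain A) (f : chain_map X Y) i :
  khom (trunc_ob X i) (trunc_ob Y i) := cut_pr _ _ ∘ f i ∘ cut_in _ _.

Fact trunc_mapP X Y (f : chain_map X Y) i :
  cd (trunc_cochain Y) i ∘ trunc_map_at f i =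
  trunc_map_at f (i + 1) ∘ cd (trunc_cochain X) i.
Proof.
have [ib|nib] := orP (orbN (inab i)); last by apply: zero_src; apply: cut_zero.
have [jb|njb] := orP (orbN (inab (i + 1))); last by apply: zero_tgt; apply: cut_zero.
rewrite /= /trunc_d /trunc_map_at -!kcompA.
rewrite (kcompA (cut_in (inab (i + 1)) _)) cut_prK // kcomp1m.
rewrite (kcompA (cut_in (inab i) _)) cut_prK // kcomp1m.
by rewrite (kcompA (cd Y i)) cmapP -!kcompA.
Qed.

Definition trunc_map X Y (f : chain_map X Y) :
  chain_map (trunc_cochain X) (trunc_cochain Y) :=
  @ChainMap _ _ (trunc_cochain X) (trunc_cochain Y) (trunc_map_at f) (trunc_mapP f).

Definition trunc : functor (C_all A) (C_ A a b).
Proof.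
exists (fun X => exist (concentrated a b) (trunc_cochain X) (@trunc_concentrated X))
  (fun X Y f => trunc_map f) => [X|X Y Z g f]; apply: chain_map_eq => i /=.
- by rewrite /trunc_map_at kcompm1 cut_inK.
- have [ib|nib] := orP (orbN (inab i)); last by apply: zero_src; apply: cut_zero.
  rewrite /trunc_map_at /= -!kcompA (kcompA (cut_in _ _) (cut_pr _ _)).
  by rewrite cut_prK // kcomp1m.
Defined.

Fact trunc_inP (X : C_ A a b) i : cd (sval X) i ∘ cut_in (inab i) (sval X i) =
  cut_in (inab (i + 1)) (sval X (i + 1)) ∘ cd (trunc_cochain (sval X)) i.
Proof. by rewrite /= /trunc_d !kcompA cut_prKz ?kcomp1m //; apply: svalP. Qed.

Definition trunc_in (X : C_ A a b) : Mor (trunc (sval X)) X :=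
  @ChainMap _ _ (trunc_cochain (sval X)) (sval X)
    (fun i => cut_in (inab i) (sval X i)) (trunc_inP X).

Fact trunc_prP (X : C_ A a b) i :
  cd (trunc_cochain (sval X)) i ∘ cut_pr (inab i) (sval X i) =
  cut_pr (inab (i + 1)) (sval X (i + 1)) ∘ cd (sval X) i.
Proof. by rewrite /= /trunc_d -!kcompA cut_prKz ?kcompm1 //; apply: svalP. Qed.

Definition trunc_pr (X : C_ A a b) : Mor X (trunc (sval X)) :=
  @ChainMap _ _ (sval X) (trunc_cochain (sval X))
    (fun i => cut_pr (inab i) (sval X i)) (trunc_prP X).

Lemma trunc_inK X : compm (trunc_pr X) (trunc_in X) = idm (trunc (sval X)).
Proof. by apply: chain_map_eq => i /=; apply: cut_inK. Qed.

Lemma trunc_prK X : compm (trunc_in X) (trunc_pr X) = idm X.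
Proof. by apply: chain_map_eq => i /=; apply: cut_prKz; apply: svalP. Qed.

Lemma trunc_in_nat (X Y : C_ A a b) (f : Mor X Y) :
  compm (trunc_in Y) (fmap trunc (f : Mor (c := C_all A) (sval X) (sval Y))) =
  compm f (trunc_in X).
Proof.
by apply: chain_map_eq => i /=; rewrite !kcompA cut_prKz ?kcomp1m //; apply: svalP.
Qed.

(** The two conditions of non-extendability. The degrees are written [i + 1]
    so that the differentials into and out of degree [a] or [b] compose on the
    nose, without a cast. *)
Definition left_tight (X : cochain A) : Prop := forall i, i + 1 = a ->
  forall (w : A) (u : khom w (X (i + 1))), cd X (i + 1) ∘ u = 0 -> u = 0.

Definition right_tight (Y : cochain A) : Prop := forall i, i + 1 = b ->
  forall (z : A) (v : khom (Y (i + 1)) z), v ∘ cd Y i = 0 -> v = 0.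

(** The extension by zero of [s : trunc Z -> X] commutes with the differentials
    except possibly from degree [a - 1] to degree [a]; there the defect is
    annihilated by [d_X^a], which is monic. *)
Lemma trunc_couniversal (X : C_ A a b) : left_tight (sval X) ->
  couniversal (T := trunc) (trunc_in X).
Proof.
move=> tX Z s; pose s' i : khom (cut (inab i) (Z i)) (sval X i) := cmap s i.
have sP i : cd (sval X) i ∘ (s' i ∘ cut_pr (inab i) (Z i)) =
            (s' (i + 1) ∘ cut_pr (inab (i + 1)) (Z (i + 1))) ∘ cd Z i.
  have dZ j : cd (sval X) j ∘ s' j =
      s' (j + 1) ∘ (cut_pr _ (Z (j + 1)) ∘ cd Z j ∘ cut_in _ _) by exact: (cmapP s j).
  have [ib|nib] := orP (orbN (inab i)).
    by rewrite kcompA dZ -!kcompA cut_prK // kcompm1.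
  have [jb|njb] := orP (orbN (inab (i + 1))); last first.
    by apply: zero_tgt; apply: (svalP X).
  rewrite (zero_src (cd (sval X) i) 0) ?kcomp0m; last exact: (svalP X).
  (* Here [i + 1 = a]: the left side vanishes since [X i] is zero. *)
  apply/esym/tX; first by lia.
  rewrite !kcompA dZ -!kcompA (kcompA (cut_in _ _)) cut_prK // kcomp1m.
  by rewrite cdd !kcompm0.
exists (ChainMap sP); split=> [|u uE]; apply: chain_map_eq => i /=.
- rewrite !kcompA cut_prKz ?kcomp1m; last exact: svalP.
  by rewrite -kcompA cut_inK kcompm1.
- rewrite /s' -uE /= !kcompA cut_prKz ?kcomp1m; last exact: svalP.
  have [ib|nib] := orP (orbN (inab i)); first by rewrite -kcompA cut_prK ?kcompm1.
  by apply: zero_tgt; apply: (svalP X).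
Qed.

(** Dually, the only possible defect goes from degree [b] to degree [b + 1], and
    it is annihilated by precomposition with [d_Y^(b-1)]. *)
Lemma trunc_universal (Y : C_ A a b) : right_tight (sval Y) ->
  universal (T := trunc) (trunc_pr Y).
Proof.
move=> tY Z r; pose r' i : khom (sval Y i) (cut (inab i) (Z i)) := cmap r i.
have dZ j : (cut_pr _ (Z (j + 1)) ∘ cd Z j ∘ cut_in _ _) ∘ r' j =
    r' (j + 1) ∘ cd (sval Y) j by exact: (cmapP r j).
have rP i : cd Z i ∘ (cut_in (inab i) (Z i) ∘ r' i) =
            (cut_in (inab (i + 1)) (Z (i + 1)) ∘ r' (i + 1)) ∘ cd (sval Y) i.
  have [jb|njb] := orP (orbN (inab (i + 1))).
    by rewrite -[RHS]kcompA -dZ !kcompA cut_prK // kcomp1m.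
  have [ib|nib] := orP (orbN (inab i)); last first.
    by apply: zero_src; apply: (svalP Y).
  rewrite (zero_tgt (cd (sval Y) i) 0) ?kcompm0; last exact: (svalP Y).
  (* Here [i = b]: the right side vanishes since [Y (i + 1)] is zero. *)
  have [j jE] : exists j, i = j + 1 by exists (i - 1); rewrite subrK.
  subst i; apply: tY; first by lia.
  rewrite -!kcompA -dZ !kcompA -(kcompA (cd Z _) (cut_in _ _)) cut_prK // kcompm1.
  by rewrite cdd !kcomp0m.
exists (ChainMap rP); split=> [|u uE]; apply: chain_map_eq => i /=.
- rewrite -!kcompA cut_prKz ?kcompm1; last exact: svalP.
  by rewrite kcompA cut_inK kcomp1m.
- rewrite /r' -uE /= -!kcompA cut_prKz ?kcompm1; last exact: svalP.
  have [ib|nib] := orP (orbN (inab i)); first by rewrite kcompA cut_prK ?kcomp1m.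
  by apply: zero_src; apply: (svalP Y).
Qed.

End Truncation.

(** * Compression and periodic complexes *)

Section Compression.
Variables (k : comPzRingType) (A : additive_kcat k) (m : nat).

Definition per_forget : functor (C_per A m) (C_all A) :=
  @Functor (C_per A m) (C_all A) (fun Z => sval Z) (fun Z W f => Defs.pmap f)
    (fun Z => erefl) (fun X Y Z g f => erefl).

(** Periodicity of complexes is an equality of objects; [transport] is the
    induced isomorphism. Being total in [x] and [y], it can be used under a sum
    whose index carries no proof of this equality. *)
Definition transport (x y : A) : khom x y :=
  match pselect (x = y) with
  | left e => match e in _ = z return khom x z with erefl => kid x end
  | right _ => 0
  end.

Lemma transport_id x : transport x x = kid x.
Proof.
by rewrite /transport; case: pselect => // e; rewrite (Prop_irrelevance e erefl).
Qed.

Lemma transport_trans x y z : x = y ->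
  transport y z ∘ transport x y = transport x z.
Proof. by move->; rewrite transport_id kcompm1. Qed.

(** Together with its converse below, this trades equalities of arrows with
    different endpoints for commutative squares. *)
Lemma AArrow_transport x y x' y' (f : khom x y) (f' : khom x' y') :
  AArrow f = AArrow f' -> transport y y' ∘ f = f' ∘ transport x x'.
Proof.
move=> e; pose Q (c : arrow (category_of A)) :=
  transport y (tgt c) ∘ f = (mor c : khom _ _) ∘ transport x (src c).
suff : Q (AArrow f') by [].
by rewrite -e /Q /= !transport_id kcomp1m kcompm1.
Qed.

Lemma transport_AArrow x y x' y' (f : khom x y) (f' : khom x' y') :
  x = x' -> y = y' -> transport y y' ∘ f = f' ∘ transport x x' ->
  AArrow f = AArrow f'.
Proof.
move=> ex ey; subst x' y'.
by rewrite !transport_id kcomp1m kcompm1 => ->.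
Qed.

Lemma bigpr_transport (X : int -> A) s s' l : s = s' ->
  bigpr X s' l ∘ transport (bigdsum X s) (bigdsum X s') = bigpr X s l.
Proof. by move->; rewrite transport_id kcompm1. Qed.

Lemma bigin_transport (X : int -> A) s s' l : s = s' ->
  transport (bigdsum X s) (bigdsum X s') ∘ bigin X s l = bigin X s' l.
Proof. by move->; rewrite transport_id kcomp1m. Qed.

Lemma bigpr_ext (X : int -> A) s z (u v : khom z (bigdsum X s)) : uniq s ->
  (forall i, i \in s -> bigpr X s i ∘ u = bigpr X s i ∘ v) -> u = v.
Proof.
move=> us uv; rewrite -(kcomp1m u) -(kcomp1m v) -bigdsum_id // !kcomp_suml.
by apply: eq_big_seq => i /uv; rewrite -!kcompA => ->.
Qed.

Section Bounded.
Variable X : C_b A.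
Notation Xc := (sval X).
Notation S := (supp m X).

(** Outside the support the summand is zero, so the equation of [bigpr_in] holds
    for every index in the class. *)
Lemma supp_bigpr_in i l : mcong m l i ->
  bigpr Xc (S i) l ∘ bigin Xc (S i) l = kid (Xc l).
Proof.
move=> e; have [lin|lout] := boolP (l \in S i); first exact: bigpr_in.
by apply: zero_src; apply: (out_supp e lout).
Qed.

Lemma Fd_pr i l : mcong m l i ->
  bigpr Xc (S (i + 1)) (l + 1) ∘ Fd m X i = cd Xc l ∘ bigpr Xc (S i) l.
Proof.
move=> e; apply: bigdsum_ext (supp_uniq _ _ _) _ => j /mem_supp_cong ej.
rewrite -[LHS]kcompA Fd_in // kcompA -[RHS]kcompA.
have [->|ne] := eqVneq j l.
  by rewrite !supp_bigpr_in ?kcomp1m ?kcompm1 //; apply: mcongS.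
by rewrite !bigpr_in0 ?kcomp0m ?kcompm0 // 1?eq_sym // (inj_eq (addIr _)).
Qed.

(** The projection of the compression onto the summand indexed by the degree
    itself, that is, onto [X] among all its shifts by multiples of [m]. *)
Definition Fpr : chain_map (Fcochain m X) Xc :=
  @ChainMap _ _ (Fcochain m X) Xc (fun i => bigpr Xc (S i) i)
    (fun i => esym (Fd_pr (erefl : mcong m i i))).

Definition Fin : chain_map Xc (Fcochain m X) :=
  @ChainMap _ _ Xc (Fcochain m X) (fun i => bigin Xc (S i) i)
    (fun i => Fd_in X (erefl : mcong m i i)).

Lemma Fpr_Fin : compm (c := C_all A) Fpr Fin = idm Xc.
Proof. by apply: chain_map_eq => i; apply: supp_bigpr_in. Qed.

(** The compression of a bounded complex, being the product of its shifts by
    multiples of [m], is right adjoint to forgetting periodicity: the component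
    in degree [i] at the summand [l] must be the given map in degree [l],
    transported along [Z i = Z l]. *)
Lemma Fpr_couniversal :
  couniversal (T := per_forget) (d := Fpcochain m X) (Fpr : Mor (c := C_all A) _ _).
Proof.
move=> Z s.
pose tr i l := transport (sval Z i) (sval Z l).
pose u i : khom (sval Z i) (Fob m X i) :=
  \sum_(l <- S i) (bigin Xc (S i) l ∘ (cmap s l ∘ tr i l)).
have uE i l : mcong m l i -> bigpr Xc (S i) l ∘ u i = cmap s l ∘ tr i l.
  move=> e; have [lin|lout] := boolP (l \in S i); last first.
    by apply: zero_tgt; apply: (out_supp e lout).
  rewrite kcomp_sumr (bigD1_seq l) ?supp_uniq //= big1 ?addr0.
    by rewrite kcompA bigpr_in // kcomp1m.
  by move=> j ne; rewrite kcompA bigpr_in0 1?eq_sym // kcomp0m.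
have uP i : cd (Fcochain m X) i ∘ u i = u (i + 1) ∘ cd (sval Z) i.
  apply: bigpr_ext (supp_uniq _ _ _) _ => l' /mem_supp_cong.
  have [l ->] : exists l, l' = l + 1 by exists (l' - 1); rewrite subrK.
  move=> e1; have e : mcong m l i.
    by move: e1 => /eqP; rewrite /mcong eqz_modDr => /eqP.
  rewrite kcompA Fd_pr // -kcompA uE // [RHS]kcompA uE //.
  rewrite kcompA cmapP -!kcompA; congr (_ ∘ _).
  by apply/esym/AArrow_transport; have [_] := svalP Z _ _ (esym e).
have uper : periodic_map m (ChainMap uP).
  move=> i j e; have [eZ _] := svalP Z _ _ e.
  have eS := supp_cong X e; apply: transport_AArrow => //=.
    by rewrite /Fob eS.
  apply: bigpr_ext (supp_uniq _ _ _) _ => l /mem_supp_cong el.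
  rewrite !kcompA bigpr_transport // !uE //; last by rewrite /mcong e.
  by rewrite -kcompA transport_trans.
exists (@PChainMap _ _ _ Z (Fpcochain m X) _ uper); split=> [|v vE].
  by apply: chain_map_eq => i /=; rewrite uE // /tr transport_id kcompm1.
apply: pchain_map_eq => i /=; apply: bigpr_ext (supp_uniq _ _ _) _.
move=> l /mem_supp_cong e; rewrite uE // -vE /= -kcompA.
rewrite -(AArrow_transport (Defs.pmapP v (esym e))) kcompA.
by rewrite bigpr_transport //; apply: supp_cong.
Qed.

(** The same complex is the coproduct of the shifts, hence the left adjoint. *)
Lemma Fin_universal :
  universal (T := per_forget) (d := Fpcochain m X) (Fin : Mor (c := C_all A) _ _).
Proof.
move=> Z r.
pose tr l i := transport (sval Z l) (sval Z i).
pose u i : khom (Fob m X i) (sval Z i) :=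
  copair (S i) (fun l => tr l i ∘ cmap r l).
have uE i l : mcong m l i -> u i ∘ bigin Xc (S i) l = tr l i ∘ cmap r l.
  move=> e; have [lin|lout] := boolP (l \in S i); last first.
    by apply: zero_src; apply: (out_supp e lout).
  by rewrite copair_in ?supp_uniq.
have uP i : cd (sval Z) i ∘ u i = u (i + 1) ∘ cd (Fcochain m X) i.
  apply: bigdsum_ext (supp_uniq _ _ _) _ => l /mem_supp_cong e.
  rewrite -!kcompA Fd_in // uE // [RHS]kcompA uE; last exact: mcongS.
  rewrite -[RHS]kcompA -cmapP !kcompA; congr (_ ∘ _).
  by apply/esym/AArrow_transport; have [_] := svalP Z _ _ e.
have uper : periodic_map m (@ChainMap _ _ (Fcochain m X) (sval Z) u uP).
  move=> i j e; have [eZ _] := svalP Z _ _ e.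
  have eS := supp_cong X e; apply: transport_AArrow => //=.
    by rewrite /Fob eS.
  apply: bigdsum_ext (supp_uniq _ _ _) _ => l /mem_supp_cong el.
  have ejl : mcong m l j by rewrite /mcong -e.
  rewrite -!kcompA bigin_transport // !uE // kcompA transport_trans //.
  by have [] := svalP Z _ _ el.
exists (@PChainMap _ _ _ (Fpcochain m X) Z _ uper); split=> [|v vE].
  by apply: chain_map_eq => i /=; rewrite uE // /tr transport_id kcomp1m.
apply: pchain_map_eq => i /=; apply: bigdsum_ext (supp_uniq _ _ _) _.
move=> l /mem_supp_cong e; rewrite uE // -vE /= kcompA.
rewrite (AArrow_transport (Defs.pmapP v e)) -kcompA.
by rewrite bigin_transport //; apply: supp_cong.
Qed.

End Bounded.

Lemma Fpr_nat (X Y : C_b A) (f : Mor X Y) :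
  compm (c := C_all A) (Fpr Y) (Fchain m f) = compm (c := C_all A) f (Fpr X).
Proof.
apply: chain_map_eq => i /=.
apply: bigdsum_ext (supp_uniq _ _ _) _ => l /mem_supp_cong e.
rewrite -[LHS]kcompA Fmap_in // [LHS]kcompA -[RHS]kcompA.
have [->|ne] := eqVneq l i.
  by rewrite !supp_bigpr_in // kcomp1m kcompm1.
by rewrite !bigpr_in0 1?eq_sym // kcomp0m kcompm0.
Qed.

(** The interval [a..b] contains at most one integer of each class modulo [m], so
    that in these degrees all summands of the compression but one are zero. *)
Lemma trunc_Fin_Fpr (a b : int) (X : C_b A) : concentrated a b (sval X) ->
  b < a + m%:Z ->
  compm (fmap (trunc A a b) (Fin X)) (fmap (trunc A a b) (Fpr X)) =
  idm (trunc A a b (Fcochain m X)).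
Proof.
move=> cX bam; rewrite -fmapM -fmap1; apply: chain_map_eq => i /=.
have [ib|nib] := boolP (a <= i <= b); last by apply: zero_src; apply: cut_zero.
congr (_ ∘ _ ∘ _); apply: bigdsum_ext (supp_uniq _ _ _) _ => l /mem_supp_cong e.
rewrite -kcompA kcomp1m; have [->|ne] := eqVneq l i.
  by rewrite supp_bigpr_in ?kcompm1.
apply/zero_src/cX; apply/negP => lb.
move/eqP: e; rewrite eqz_mod_dvd => /dvdzP[q qE].
(* [l - i = q m], while [l] and [i] differ by less than [m]. *)
have [q0|[q1|q1]] : q = 0 \/ (1 <= q \/ q <= -1) by lia.
- by case/eqP: ne; move: qE; rewrite q0; lia.
- by move: qE; nia.
- by move: qE; nia.
Qed.

End Compression.

(** * Two left inverses given by truncation *)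

Section LeftInverses.
Variables (k : comPzRingType) (A : additive_kcat k) (a b : int).

Definition bounded_trunc : functor (C_b A) (C_ A a b) :=
  comp_functor (trunc A a b) (full_sub_forget (bounded (A := A))).

Lemma bounded_trunc_left_inverse :
  left_inverse_of (J := incl_b A a b) (T := bounded_trunc)
    (fun X => trunc_in X) (fun X => trunc_pr X).
Proof.
split=> [X Y f|X|X]; [exact: trunc_in_nat | exact: trunc_prK | exact: trunc_inK].
Qed.

Lemma bounded_trunc_couniversal (X : C_ A a b) :
  couniversal (T := trunc A a b) (trunc_in X) ->
  couniversal (T := bounded_trunc) (d := incl_b A a b X) (trunc_in X).
Proof.
move=> cX; have := couniversal_comp cX (@full_sub_couniversal _ _ (incl_b A a b X)).
by rewrite fmap1 compm1.
Qed.

Lemma bounded_trunc_universal (X : C_ A a b) :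
  universal (T := trunc A a b) (trunc_pr X) ->
  universal (T := bounded_trunc) (d := incl_b A a b X) (trunc_pr X).
Proof.
move=> uX; have := universal_comp uX (@full_sub_universal _ _ (incl_b A a b X)).
by rewrite fmap1 comp1m.
Qed.

Variable m : nat.

Definition per_trunc : functor (C_per A m) (C_ A a b) :=
  comp_functor (trunc A a b) (per_forget A m).

Definition per_counit (X : C_ A a b) :
    Mor (per_trunc (compression A m (incl_b A a b X))) X :=
  compm (trunc_in X) (fmap (trunc A a b) (Fpr m (incl_b A a b X))).

Definition per_unit (X : C_ A a b) :
    Mor X (per_trunc (compression A m (incl_b A a b X))) :=
  compm (fmap (trunc A a b) (Fin m (incl_b A a b X))) (trunc_pr X).

Lemma per_trunc_left_inverse : b < a + m%:Z ->
  left_inverse_of (J := comp_functor (compression A m) (incl_b A a b))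
    (T := per_trunc) per_counit per_unit.
Proof.
move=> bam; split=> [X Y f|X|X]; rewrite /per_counit /per_unit.
- have := congr1 (fun g => fmap (trunc A a b) g) (Fpr_nat m (fmap (incl_b A a b) f)).
  rewrite !fmapM => pN.
  by rewrite -Defs.compA pN !Defs.compA trunc_in_nat.
- apply: comp_inverse (trunc_prK X) _.
  have := congr1 (fun g => fmap (trunc A a b) g) (Fpr_Fin m (incl_b A a b X)).
  by rewrite fmapM fmap1.
- have FK := @trunc_Fin_Fpr _ _ m a b (incl_b A a b X) (svalP X) bam.
  exact: (comp_inverse FK (trunc_inK X)).
Qed.

Lemma per_counit_couniversal (X : C_ A a b) :
  couniversal (T := trunc A a b) (trunc_in X) ->
  couniversal (T := per_trunc) (d := compression A m (incl_b A a b X)) (per_counit X).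
Proof.
by move=> cX; apply: couniversal_comp cX (@Fpr_couniversal _ _ m (incl_b A a b X)).
Qed.

Lemma per_unit_universal (X : C_ A a b) :
  universal (T := trunc A a b) (trunc_pr X) ->
  universal (T := per_trunc) (d := compression A m (incl_b A a b X)) (per_unit X).
Proof.
by move=> uX; apply: universal_comp uX (@Fin_universal _ _ m (incl_b A a b X)).
Qed.

End LeftInverses.

(** * The equivalence *)

Theorem theorem2p12 (k : comPzRingType) (A : additive_kcat k) (n m : nat)
  (hn : (2 <= n)%N) (hmn : (n <= m)%N)
  (X Y : C_ A 1 n%:Z) (f : Mor X Y)
  (hX : ~ left_extendable (sval X))
  (hY : ~ right_extendable n%:Z (sval Y)) :
  [<-> irreducible (fmap (incl_b A 1 n%:Z) f);
       irreducible (fmap (incl_1n A n%:Z) f);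
       irreducible (fmap (compression A m) (fmap (incl_b A 1 n%:Z) f));
       irreducible f].
Proof.
have tX : left_tight 1 (sval X).
  move=> i i1 w u; have {i1} i0 : i = 0 by lia.
  subst i => u0; apply: (contrapT hX).
  by rewrite /= u0 kcompm0.
have tY : right_tight n%:Z (sval Y).
  move=> i iE z v v0; have {iE} iE : i = n%:Z - 1 by lia.
  subst i; apply: contrapT => v_neq0; apply: hY.
  by exists z, v.
have cX := trunc_couniversal tX.
have uY := trunc_universal tY.
have m_large : n%:Z < 1 + m%:Z by lia.
have perK := per_trunc_left_inverse A m_large.
tfae=> irr.
(* The two inclusions of [C_[1,n]] differ only in proofs of boundedness, which
   [irreducible] does not see; hence [irr] applies by conversion. *)
- apply: (@irreducible_reflect _ _ (incl_b A 0 (n%:Z + 1)) _ _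
    (fmap (incl_1n A n%:Z) f)) irr.
  exact: full_sub_reflects_split.
- apply: (irreducible_transfer perK).
  + exact: per_counit_couniversal.
  + exact: per_unit_universal.
  + by apply: irreducible_reflect irr; apply: full_sub_reflects_split.
- exact: irreducible_reflect (left_inverse_reflects_split perK) irr.
- apply: (irreducible_transfer (bounded_trunc_left_inverse A 1 n%:Z)) irr.
  + exact: bounded_trunc_couniversal.
  + exact: bounded_trunc_universal.
Qed.
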